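(* For every positive integer $d$, $\tau(\mathbb{S}^{d-1})\leq G(d)$.
   Context: $\mathbb{S}^{d-1}$ denotes the Euclidean unit sphere in $\mathbb{R}^d$ centred at the origin, and $\mu_{\mathbb{S}^{d-1}}$ its normalised (probability) surface measure (for $d=1$, the uniform probability measure on $\{-1,1\}$). A subset $S\subset\mathbb{R}^d$ is $\Delta$-free if there are no $a,b,c\in S$ (not necessarily distinct) with $a+b+c=0$. Define $$\tau(\mathbb{S}^{d-1})=\sup\{\mu_{\mathbb{S}^{d-1}}(S) : S\subset\mathbb{S}^{d-1}\text{ is Borel and }\Delta\text{-free}\}.$$ A digraph $G$ has a vertex set $V$ and an edge set $E(G)$ of ordered pairs $xy$ of distinct vertices; both $xy$ and $yx$ may be edges. A directed triangle is a directed cycle of length 3, i.e. three distinct vertices $x,y,z$ with $xy,yz,zx$ all edges. A digraph $G$ on a vertex set $V\subset\mathbb{R}^d$ is unit distance if every edge $xy\in E(G)$ satisfies $\|x-y\|_2=1$. Let $\bar t(G)$ denote the maximum number of edges in a subgraph of $G$ containing no directed triangle. Define $$G(d)=\inf\left\{\frac{\bar t(G)}{|E(G)|} : G \text{ is a finite unit distance digraph in } \mathbb{R}^d,\ |E(G)|>0\right\}.$$ *)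

(* Defs.v *)
From HB Require Import structures.
From mathcomp Require Import all_boot all_order all_algebra finmap.
From mathcomp Require Import all_classical all_reals all_analysis.

Set Implicit Arguments.
Unset Strict Implicit.
Unset Printing Implicit Defensive.

Import Order.TTheory GRing.Theory Num.Theory.
Import numFieldNormedType.Exports.

Local Open Scope classical_set_scope.
Local Open Scope ring_scope.

Section Sphere.
Context {R : realType}.

(* The library norm on ['rV[R]_d] is the sup norm; it induces the same
   topology, hence the same Borel sets, but not the same sphere. *)
Definition l2norm d (x : 'rV[R]_d) : R := Num.sqrt (\sum_i x 0 i ^+ 2).

Definition sphere d : set 'rV[R]_d := [set x | l2norm x = 1].
Arguments sphere d : clear implicits.

Definition borel d (A : set 'rV[R]_d) : Prop := <<s open >> A.

(* Lebesgue measure on R^d, as the d-fold product of the Lebesgue measure on R: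
   the measure of A is the integral over t of the measure of the slice of A
   where the first coordinate is t. The value is meaningful for Borel A. *)
Fixpoint lebesgue_rV d : set 'rV[R]_d -> \bar R :=
  match d with
  | 0 => fun A => (\1_A (0 : 'rV[R]_0))%:E
  | d'.+1 => fun A =>
      (\int[@lebesgue_measure R]_t
         lebesgue_rV [set v : 'rV[R]_d' | A (row_mx (t%:M : 'rV[R]_1) v)])%E
  end.

Definition cone d (A : set 'rV[R]_d) : set 'rV[R]_d :=
  [set x | exists t : R, exists2 u, A u & 0 < t <= 1 /\ x = t *: u].

(* In polar coordinates, the cone over A has volume the integral of
   r ^ (d - 1) * area A for r from 0 to 1, that is area A / d. *)
Definition surface_measure d (A : set 'rV[R]_d) : \bar R :=
  (d%:R%:E * lebesgue_rV (cone A))%E.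

Definition sphere_measure d (A : set 'rV[R]_d) : \bar R :=
  (surface_measure A / surface_measure (sphere d))%E.

Definition delta_free d (S : set 'rV[R]_d) : Prop :=
  ~ exists a b c, [/\ S a, S b, S c & a + b + c = 0].

Definition tau d : \bar R :=
  ereal_sup [set sphere_measure S | S in
    [set S : set 'rV[R]_d | [/\ S `<=` sphere d, borel S & delta_free S]]].

End Sphere.
Arguments tau R d : clear implicits.

Section Digraph.
Context {V : choiceType}.
Local Open Scope fset_scope.

Record digraph := Digraph {
  vertices : {fset V};
  edges : {fset V * V};
  edges_vertices : forall x y, (x, y) \in edges ->
    x \in vertices /\ y \in vertices;
  edges_neq : forall x y, (x, y) \in edges -> x != y
}.

Definition subdigraph (H G : digraph) : Prop :=
  vertices H `<=` vertices G /\ edges H `<=` edges G.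

Definition has_directed_triangle (G : digraph) : Prop :=
  exists x y z, [/\ x != y, y != z & z != x] /\
    [/\ (x, y) \in edges G, (y, z) \in edges G & (z, x) \in edges G].

(* The maximum of the k that are the number of edges of a subgraph without
   directed triangle. *)
Definition tbar (G : digraph) : nat :=
  (\max_(k < #|` edges G|.+1 |
      `[< exists H, [/\ subdigraph H G, ~ has_directed_triangle H &
                        #|` edges H| = k :> nat] >]) k)%N.

End Digraph.
Arguments digraph V : clear implicits.

Definition unit_distance (R : realType) d (G : digraph 'rV[R]_d) : Prop :=
  forall x y, (x, y) \in edges G -> l2norm (x - y) = 1.

Definition Gconst (R : realType) d : \bar R :=
  ereal_inf [set ((tbar G)%:R / #|` edges G|%:R)%:E | G in
    [set G : digraph 'rV[R]_d | unit_distance G /\ (0 < #|` edges G|)%N]].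
Arguments Gconst R d : clear implicits.

(* Main.v *)
Require Import Defs.
From HB Require Import structures.
From mathcomp Require Import all_boot all_order all_algebra finmap.
From mathcomp Require Import all_classical all_reals all_analysis.
From mathcomp Require Import perm measurable_realfun ring lra.

(* Averaging over random rotations. If Q is an orthogonal matrix and S is a
   delta-free subset of the sphere, the edges xy of a unit distance digraph G such
   that (x - y)Q lies in S form a subgraph without directed triangle, since
   (x - y) + (y - z) + (z - x) = 0. So at most tbar G edges are of this kind, and it
   remains to average over Q.

   Q is the Gram-Schmidt frame of a matrix M drawn from Lebesgue measure on a bounded
   set of invertible d x d matrices. Rotating the rows of M rotates the frame, so the
   probability that a unit vector is sent into S does not depend on the vector;
   by Fubini's theorem, averaging it over the unit ball gives the measure of S.

   That Lebesgue measure is invariant under linear isometries follows, without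
   determinants, from its translation invariance: the image measure is translation
   invariant, hence proportional to Lebesgue measure, and both agree on the unit
   ball. *)

Set Implicit Arguments.
Unset Strict Implicit.
Unset Printing Implicit Defensive.
Import Order.TTheory GRing.Theory Num.Theory.
Import numFieldNormedType.Exports.
Local Open Scope classical_set_scope.
Local Open Scope ring_scope.

(** * Borel measurability of matrix-valued maps *)

Section borel_matrix.
Context {R : realType}.

(* The measurable sets are the Borel sets, convertible to [borel] for rows. *)
HB.instance Definition _ m n := @isMeasurable.Build (sigma_display (@open
  'M[R]_(m, n)))
  'M[R]_(m, n) <<s open >> (@sigma_algebra0 _ setT _) (@sigma_algebraC _ _)
  (@sigma_algebra_bigcup _ setT _).

Lemma measurable_coord m n (i : 'I_m) (j : 'I_n) :
  measurable_fun setT (fun M : 'M[R]_(m, n) => M i j).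
Proof.
apply: (@measurability _ _ _ R _ _ (@RGenOpens.G R));
  first exact: RGenOpens.measurableE.
move=> _ [_ [x [y ->]] <-]; rewrite setTI; apply: sub_sigma_algebra.
by apply: open_comp => [z _|]; [exact: coord_continuous|exact: itv_open].
Qed.

(** Boxes with rational centres and radii [k.+1%:R^-1] form a countable base. The preimage of an
    open set is thus a countable union of preimages of boxes, each a finite intersection of
    conditions on single entries. *)
Lemma measurable_fun_matrix d (T : measurableType d) m n (f : T -> 'M[R]_(m, n)) :
  (forall i j, measurable_fun setT (fun x => f x i j)) -> measurable_fun setT f.
Proof.
move=> mf; apply: (measurability (@open 'M[R]_(m, n))) => //.
move=> _ [U oU <-]; rewrite setTI.
pose box (q : 'M[rat]_(m, n) * nat) :=
  [set M : 'M[R]_(m, n) |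
    forall i j, ball (ratr (q.1 i j) : R) q.2.+1%:R^-1 (M i j)].
have -> : f @^-1` U = \bigcup_q
    (if `[< box q `<=` U >] then f @^-1` box q else set0).
  apply/seteqP; split => [x Ux|x [q _]]; last first.
    by case: asboolP => // qU; exact: qU.
  have /nbhs_ballP[e /= e0 eU] := open_nbhs_nbhs (conj oU Ux).
  have [k] : exists k, (k.+1%:R^-1 : R) < e / 2.
    by have [k _ /(_ k (leqnn k))] := near_infty_natSinv_lt (PosNum (divr_gt0 e0
      (ltr0Sn R 1))); exists k.
  move=> ke.
  have k0 : (0 : R) < k.+1%:R^-1 by rewrite invr_gt0.
  have qP i j : exists q : rat, ball (ratr q : R) k.+1%:R^-1 (f x i j).
    have [|q] := @rat_in_itvoo R (f x i j - k.+1%:R^-1) (f x i j + k.+1%:R^-1).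
      by rewrite ltrD2l; rewrite gtrN.
    rewrite in_itv /= => /andP[q1 q2]; exists q.
    rewrite /ball /= ltr_norml.
    move: (ratr q) (f x i j) (k.+1%:R^-1 : R) q1 q2 => a b r q1 q2.
    by apply/andP; split; lra.
  pose Q := \matrix_(i, j) projT1 (cid (qP i j)).
  have Qx i j : ball (ratr (Q i j) : R) k.+1%:R^-1 (f x i j).
    by rewrite mxE; case: cid.
  exists (Q, k) => //; rewrite asboolT //= => M QM; apply: eU; split => // i j.
  (* Both [f x i j] and [M i j] are within [k.+1%:R^-1 < e / 2] of the same rational. *)
  have := ball_triangle (ball_sym (Qx i j)) (QM i j).
  by apply: le_ball; rewrite (splitr e) lerD // ltW.
apply: countable_bigcupT_measurable; first exact: countableP.
move=> q; case: asboolP => // _.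
have -> : f @^-1` box q = \bigcap_(ij in [set: 'I_m * 'I_n])
   ((fun x => f x ij.1 ij.2) @^-1` ball (ratr (q.1 ij.1 ij.2) : R) q.2.+1%:R^-1).
  apply/seteqP; split => [x xq ij _|x xq i j]; first exact: xq.
  exact: (xq (i, j)).
apply: fin_bigcap_measurable => // ij _.
by rewrite -[X in measurable X]setTI; apply: mf => //; apply: open_measurable;
  exact: ball_open.
Qed.
End borel_matrix.

(** * Lebesgue measure on rows: measure structure and translation invariance *)

Section lebesgue_measure_rV.
Context {R : realType}.
Local Notation mu n := (@lebesgue_rV R n).

Lemma measurable_fun_row_mx d (T : measurableType d) n
    (f : T -> R) (g : T -> 'rV[R]_n) :
  measurable_fun setT f -> measurable_fun setT g ->
  measurable_fun setT (fun x => row_mx ((f x)%:M : 'rV_1) (g x)).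
Proof.
move=> mf mg; apply: measurable_fun_matrix => i j.
case: (fintype.splitP j) => k jk.
  have -> : j = lshift n k by apply: val_inj.
  under eq_fun do rewrite row_mxEl mxE !ord1 eqxx mulr1n.
  exact: mf.
have -> : j = rshift 1 k by apply: val_inj.
under eq_fun do rewrite row_mxEr.
exact: (measurableT_comp (measurable_coord i k)).
Qed.

Section glue.
Context n (m : {sigma_finite_measure set 'rV[R]_n -> \bar R}).

(** Carries the product measure over to rows of length [n.+1]. *)
Definition glue (x : measurableTypeR R * 'rV[R]_n) : 'rV[R]_n.+1 :=
  row_mx (x.1%:M : 'rV_1) x.2.

Definition unglue (v : 'rV[R]_n.+1) : measurableTypeR R * 'rV[R]_n :=
  (v 0 0, @rsubmx R 1 1 n v).

Lemma glueK : cancel glue unglue.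
Proof.
move=> [t v]; rewrite /unglue /glue /= row_mxKr; congr pair.
transitivity (row_mx (t%:M : 'rV_1) v 0 (lshift n 0)).
  by congr (fun_of_matrix _ _ _); exact: val_inj.
by rewrite row_mxEl mxE.
Qed.

Lemma unglueK : cancel unglue glue.
Proof.
move=> v; rewrite /unglue /glue /=.
have -> : (v 0 0)%:M = @lsubmx R 1 1 n v.
  apply/rowP => i; rewrite !mxE !ord1 eqxx mulr1n; congr (v _ _).
  exact: val_inj.
exact: (@hsubmxK R 1 1 n).
Qed.

Lemma measurable_glue : measurable_fun setT glue.
Proof. by apply: measurable_fun_row_mx; [exact: measurable_fst|exact:
  measurable_snd]. Qed.

Lemma measurable_unglue : measurable_fun setT unglue.
Proof.
apply: measurable_fun_pair; first exact: measurable_coord.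
apply: measurable_fun_matrix => i j.
under eq_fun do rewrite mxE.
exact: measurable_coord.
Qed.

Definition glued := pushforward (lebesgue_measure \x m)%E glue.

Let glued0 : glued set0 = 0%E.
Proof. by rewrite /glued /pushforward preimage_set0 measure0. Qed.

Let glued_ge0 A : (0 <= glued A)%E.
Proof. by rewrite /glued /pushforward; apply: measure_ge0. Qed.

Let glued_sigma_additive : semi_sigma_additive glued.
Proof.
move=> F mF tF mUF; rewrite /glued /pushforward preimage_bigcup.
have mpre k : measurable (glue @^-1` F k).
  by rewrite -[X in measurable X]setTI; exact: measurable_glue.
apply: measure_semi_sigma_additive => //.
  apply/trivIsetP => i j _ _ ij; rewrite -preimage_setI.
  by move/trivIsetP : tF => ->//; rewrite preimage_set0.
exact: bigcupT_measurable.
Qed.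

HB.instance Definition _ := isMeasure.Build _ _ _ glued
  glued0 glued_ge0 glued_sigma_additive.

Lemma sigma_finite_glued : sigma_finite setT glued.
Proof.
have [F TF Foo] : sigma_finite setT (lebesgue_measure \x m)%E.
  have /sigma_finiteP[F [TF ndF Foo]] := sigma_finiteT (@lebesgue_measure R).
  have /sigma_finiteP[G [TG ndG Goo]] := sigma_finiteT m.
  (* Both exhaustions are increasing, so the index [maxn k l] serves both coordinates. *)
  exists (fun n => F n `*` G n).
    apply/esym; rewrite -subTset => -[x y] _.
    have [k _ Fx] : (\bigcup_i F i) x by rewrite -TF.
    have [l _ Gy] : (\bigcup_i G i) y by rewrite -TG.
    exists (maxn k l) => //; split => /=.
      by move: x Fx; apply/subsetPset/ndF; exact: leq_maxl.
    by move: y Gy; apply/subsetPset/ndG; exact: leq_maxr.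
  move=> k; have [mF Fk] := Foo k; have [mG Gk] := Goo k.
  split; first exact: measurableX.
  by rewrite product_measure1E// lte_mul_pinfty// ge0_fin_numE.
have imE k : glue @` F k = unglue @^-1` F k.
  apply/seteqP; split => [_ [x Fx <-]|v Fv] /=; first by rewrite glueK.
  by exists (unglue v) => //; rewrite unglueK.
exists (fun k => unglue @^-1` F k).
  by rewrite -preimage_bigcup -TF preimage_setT.
move=> k; have [mF oo] := Foo k; split.
  by rewrite -[X in measurable X]setTI; exact: measurable_unglue.
rewrite /glued /pushforward -comp_preimage.
by rewrite (_ : unglue \o glue = id) // funeqE => x; exact: glueK.
Qed.
HB.instance Definition _ := Measure_isSigmaFinite.Build _ _ _ glued
  sigma_finite_glued.
End glue.

(** By induction from the Dirac mass, the iterated integral is the image under [glue] of a product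
    measure. The existential lets the induction carry the measure structure, which is then
    transferred to [lebesgue_rV] itself. *)
Lemma lebesgue_rV_sigma_finite n :
  exists m : {sigma_finite_measure set 'rV[R]_n -> \bar R}, m = mu n :> (_ -> _).
Proof.
elim: n => [|n [m IH]].
  by exists \d_(0 : 'rV[R]_0).
exists (glued m); apply/funext => A /=; rewrite /glued /pushforward -IH.
apply: eq_integral => t _ /=; congr (m _); apply/seteqP; split => v.
  by move=> /xsectionP.
by move=> Av; exact/xsectionP.
Qed.

Let mu0 n : mu n set0 = 0%E.
Proof. by have [m <-] := lebesgue_rV_sigma_finite n; exact: measure0. Qed.
Let mu_ge0 n A : (0 <= mu n A)%E.
Proof. by have [m <-] := lebesgue_rV_sigma_finite n; exact: measure_ge0. Qed.
Let mu_sigma n : semi_sigma_additive (mu n).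
Proof. 
by have [m <-] := lebesgue_rV_sigma_finite n; exact: measure_semi_sigma_additive.
Qed.
HB.instance Definition _ n := isMeasure.Build _ _ _ (mu n) (@mu0 n) (@mu_ge0 n)
  (@mu_sigma n).
Let mu_finite n : sigma_finite setT (mu n).
Proof.
by have [m <-] := lebesgue_rV_sigma_finite n; exact: sigma_finiteT.
Qed.
HB.instance Definition _ n := Measure_isSigmaFinite.Build _ _ _ (mu n)
  (@mu_finite n).

(** Lebesgue measure is determined by its values on the intervals []b, c]], whose length a shift
    preserves. *)
Lemma lebesgue_measureDr (a : R) (A : set R) : measurable A ->
  pushforward lebesgue_measure ((fun x => x + a) : R -> measurableTypeR R) A
  = lebesgue_measure A.
Proof.
move=> mA; apply/esym/lebesgue_measure_unique => //=.
  by apply: measurable_funD.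
move=> ma _ [[b c]] _ <-.
rewrite /pushforward.
have -> : (fun x => x + a) @^-1` `]b, c]%classic = `]b - a, c - a]%classic.
  by apply/seteqP; split => x /=; rewrite !in_itv /= ltrBlDr lerBrDr.
rewrite !lebesgue_measure_itv/= !lte_fin ltrD2r.
by rewrite -!EFinB opprB addrA subrK.
Qed.

Definition slice n (A : set 'rV[R]_n.+1) (t : R) : set 'rV[R]_n :=
  [set v | A (row_mx (t%:M : 'rV_1) v)].

Lemma lebesgue_rVS n (A : set 'rV[R]_n.+1) :
  mu n.+1 A = (\int[@lebesgue_measure R]_t mu n (slice A t))%E.
Proof. by []. Qed.

Lemma measurable_slice n (A : set 'rV[R]_n.+1) t :
  measurable A -> measurable (slice A t).
Proof.
move=> mA; rewrite -[X in measurable X]setTI.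
by apply: (measurable_fun_row_mx (f := cst t) (g := id)).
Qed.

Lemma measurable_fun_slice n (A : set 'rV[R]_n.+1) :
  measurable A -> measurable_fun setT (fun t : R => mu n (slice A t)).
Proof.
move=> mA.
have mG : measurable (@glue n @^-1` A).
  by rewrite -[X in measurable X]setTI; exact: measurable_glue.
rewrite (_ : (fun _ => _) = mu n \o xsection (@glue n @^-1` A)).
  exact: measurable_fun_xsection.
apply/funext => t /=; congr (mu n _); apply/seteqP; split => v.
  by move=> Av; exact/xsectionP.
by move=> /xsectionP.
Qed.

(** Induction on the dimension: the first coordinate of [a] shifts the integration variable, the
    others shift each slice, which the induction hypothesis absorbs. *)
Lemma lebesgue_rV_translate n (a : 'rV[R]_n) (A : set 'rV[R]_n) :
  measurable A -> mu n ((fun x => x + a) @^-1` A) = mu n A.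
Proof.
elim: n a A => [|n IH] a A mA.
  congr (mu 0 _); apply/seteqP; split => x /=; by rewrite (thinmx0 a) addr0.
rewrite !lebesgue_rVS.
transitivity (\int[@lebesgue_measure R]_t mu n (slice A (t + a 0 0)%R))%E.
  apply: eq_integral => t _; rewrite -(IH (@rsubmx R 1 1 n a) (slice A (t + a 0
    0)%R)); last first.
    exact: measurable_slice.
  congr (mu n _); apply/funext => v; rewrite /slice /=; congr (A _).
  rewrite -[X in _ + X](unglueK a) /glue /unglue /=.
  by rewrite (@add_row_mx _ 1 1 n) -raddfD.
have mh := measurable_fun_slice mA.
transitivity (\int[pushforward lebesgue_measure
    ((fun x => x + a 0 0)%R : R -> measurableTypeR R)]_t mu n (slice A t))%E.
  rewrite ge0_integral_pushforward //=.
  by apply: measurable_funD.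
apply: eq_measure_integral => [|ma B mB _]; last exact: lebesgue_measureDr.
by apply: measurable_funD.
Qed.
End lebesgue_measure_rV.

(** * Integration by slices; volumes of cubes, balls and open sets *)

Section balls_and_cubes.
Context {R : realType}.
Local Notation mu n := (@lebesgue_rV R n).

Lemma fubini_slices m n (D : set ('rV[R]_m * 'rV[R]_n)) : measurable D ->
  (\int[mu m]_x mu n [set y | D (x, y)] =
   \int[mu n]_y mu m [set x | D (x, y)])%E.
Proof.
move=> mD; have := indic_fubini_tonelli (mu m) (mu n) mD.
rewrite (indic_fubini_tonelli_FE (mu n) mD) (indic_fubini_tonelli_GE (mu m) mD).
under eq_integral => x _.
  rewrite /= (_ : xsection D x = [set y | D (x, y)]).
    over.
  by apply/seteqP; split => y /xsectionP.
move=> ->; apply: eq_integral => y _ /=; congr (mu m _).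
by apply/seteqP; split => x /ysectionP.
Qed.

(** The inner measure is [c] on [E] and zero elsewhere. This evaluates a side of a Tonelli exchange
    once an invariance makes all slices over [E] equally large. *)
Lemma integral_measure_slices m n (E : set 'rV[R]_m) (P : 'rV[R]_m -> set
  'rV[R]_n) c :
  measurable E -> (forall x, E x -> mu n (P x) = c) ->
  (\int[mu m]_x mu n [set y | E x /\ P x y] = c * mu m E)%E.
Proof.
move=> mE Pc; rewrite -integral_cst // [RHS]integral_mkcond.
apply: eq_integral => x _; rewrite patchE; case: ifPn => [|].
  rewrite inE => Ex; rewrite -(Pc x Ex); congr (mu n _).
  by apply/seteqP; split => y // [].
rewrite notin_setE => nEx; rewrite (_ : [set _ | _] = set0) ?measure0 //.
by apply/seteqP; split => y // [].
Qed.

(** The squared Euclidean norm is a polynomial, which keeps square roots out of continuity and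
    measurability arguments. *)
Definition sqn n (x : 'rV[R]_n) : R := \sum_i x 0 i ^+ 2.

Lemma measurable_sqn n : measurable_fun setT (@sqn n).
Proof.
by apply: measurable_sum => i; apply: measurable_funX; exact: measurable_coord.
Qed.

Lemma sqnN n (x : 'rV[R]_n) : sqn (- x) = sqn x.
Proof. by apply: eq_bigr => i _; rewrite mxE sqrrN. Qed.

(** Here [r] bounds the squared norm: the radius is the square root of [r]. *)
Definition sqball n (r : R) : set 'rV[R]_n := [set x | sqn x <= r].

Lemma measurable_sqball n r : measurable (@sqball n r).
Proof.
rewrite -[X in measurable X]setTI.
have := @measurable_sqn n measurableT `]-oo, r]%classic.
rewrite (_ : @sqn n @^-1` _ = sqball r); first by apply.
by apply/seteqP; split => x; rewrite /= in_itv.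
Qed.

Definition cube n (e : R) : set 'rV[R]_n := [set x | forall i, `|x 0 i| <= e].

Lemma lebesgue_rV_cube n (e : R) : 0 <= e -> mu n (@cube n e) = ((2 * e) ^+ n)%:E.
Proof.
move=> e0; elim: n => [|n IH].
  by rewrite /= indicE mem_set // => -[].
rewrite lebesgue_rVS exprS EFinM -IH muleC.
have -> : (2 * e)%:E = lebesgue_measure (`[- e, e]%classic : set R).
  rewrite lebesgue_measure_itv /= lte_fin; case: ltP.
     by rewrite -EFinB => _; congr (_%:E); lra.
  by move=> h; congr (_%:E); lra.
rewrite -integral_cst // [RHS]integral_mkcond.
apply: eq_integral => t _; rewrite patchE.
have sl v : slice (cube e) t v <-> `|t| <= e /\ @cube n e v.
  have E0 : row_mx (t%:M : 'rV_1) v 0 (lshift n 0) = t by rewrite row_mxEl mxE.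
  have ES k : row_mx (t%:M : 'rV_1) v 0 (rshift 1 k) = v 0 k by rewrite row_mxEr.
  split=> [h|[te h] i].
    split=> [|k]; first by rewrite -[X in `|X|]E0; exact: h.
    by rewrite -[X in `|X|]ES; exact: h.
  case: (@fintype.splitP 1 n i) => k ik.
    rewrite (_ : i = lshift n (0 : 'I_1)); last by apply: val_inj;
      rewrite /= ik ord1.
    by rewrite [X in `|X|]E0.
  rewrite (_ : i = rshift 1 k); last exact: val_inj.
  by rewrite [X in `|X|]ES; exact: h.
case: ifPn => [|].
  rewrite inE /= in_itv /= -ler_norml => te; congr (mu n _).
  by apply/seteqP; split => v; rewrite sl // => -[].
rewrite notin_setE /= in_itv /= -ler_norml => /negP nte.
rewrite (_ : slice _ _ = set0) ?measure0 //.
by apply/seteqP; split => v // /sl[te]; rewrite te in nte.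
Qed.

Lemma measurable_cube n e : measurable (@cube n e).
Proof.
have -> : @cube n e = \bigcap_(i in [set: 'I_n]) ((fun x => x 0 i) @^-1` `[- e,
  e]%classic).
  apply/seteqP; split=> [x xe i _|x xe i]; first by rewrite /= in_itv /= -ler_norml.
  by have := xe i I; rewrite /= in_itv /= -ler_norml.
apply: fin_bigcap_measurable => // i _.
by rewrite -[X in measurable X]setTI; apply: measurable_coord.
Qed.

Lemma sqball_subset_cube n r : 0 <= r -> @sqball n r `<=` cube (r + 1).
Proof.
move=> r0 x xr i; have xi : x 0 i ^+ 2 <= r.
  apply: le_trans xr; rewrite /sqn (bigD1 i) //= lerDl.
  by apply: sumr_ge0 => j _; exact: sqr_ge0.
(* Squares are compared, using [r <= (r + 1) ^+ 2]. *)
rewrite -(@ler_pXn2r _ 2) // ?nnegrE //; last lra.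
by rewrite real_normK ?num_real //; nra.
Qed.

Lemma lebesgue_rV_sqball_lty n r : 0 <= r -> (mu n (sqball r) < +oo)%E.
Proof.
move=> r0; apply: (@le_lt_trans _ _ (mu n (cube (r + 1)))).
  apply: le_measure; rewrite ?inE; [exact: measurable_sqball|exact:
    measurable_cube|].
  exact: sqball_subset_cube.
by rewrite lebesgue_rV_cube ?ltry //; lra.
Qed.

(** Balls are those of the sup norm, so once a point of [U] is translated to the origin, the cube of
    half-side [e / 2] fits inside. *)
Lemma lebesgue_rV_open_gt0 n (U : set 'rV[R]_n) : open U -> U !=set0 -> (0 < mu n
  U)%E.
Proof.
move=> oU [p Up]; have mU : measurable U by exact: sub_sigma_algebra.
have /nbhs_ballP[e /= e0 eU] := open_nbhs_nbhs (conj oU Up).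
rewrite -(lebesgue_rV_translate p mU).
apply: (@lt_le_trans _ _ (mu n (cube (e / 2)))).
  by rewrite lebesgue_rV_cube ?lte_fin ?exprn_gt0 //; lra.
apply: le_measure; rewrite ?inE; first exact: measurable_cube.
  rewrite -[X in measurable X]setTI.
  apply: measurable_fun_matrix => // i j.
  under eq_fun do rewrite mxE.
  by apply: measurable_funD => //; exact: measurable_coord.
move=> x xe; apply: eU; split => // i j; rewrite ord1 mxE /ball /=.
rewrite opprD addrCA subrr addr0 normrN.
by apply: le_lt_trans (xe j) _; lra.
Qed.

End balls_and_cubes.

(** * Invariance of Lebesgue measure under linear isometries *)

Section isometry_invariance.
Context {R : realType}.
Local Notation mu n := (@lebesgue_rV R n).

(* Otherwise unification unfolds the iterated integrals. *)
Local Opaque lebesgue_rV.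

Lemma mule_injl (b x y : \bar R) :
  (0 < b)%E -> (b < +oo)%E -> (b * x = b * y)%E -> x = y.
Proof.
move=> b0 boo bxy.
have bfin : b \is a fin_num by rewrite ge0_fin_numE // ltW.
by apply/le_anti; rewrite -(lee_pmul2l bfin b0 x) -(lee_pmul2l bfin b0 y) bxy lexx.
Qed.

Lemma continuous_bigsum (T : topologicalType) (I : Type) (s : seq I) (F : I -> T
  -> R) :
  (forall i, continuous (F i)) -> continuous (fun x => \sum_(i <- s) F i x).
Proof.
move=> cF; elim: s => [|i s IH].
  by under eq_fun do rewrite big_nil; exact: cst_continuous.
under eq_fun do rewrite big_cons.
by move=> x; apply: continuousD; [exact: cF|exact: IH].
Qed.

Lemma continuous_bigprod (T : topologicalType) (I : Type) (s : seq I) (F : I -> T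
  -> R) :
  (forall i, continuous (F i)) -> continuous (fun x => \prod_(i <- s) F i x).
Proof.
move=> cF; elim: s => [|i s IH].
  by under eq_fun do rewrite big_nil; exact: cst_continuous.
under eq_fun do rewrite big_cons.
by move=> x; apply: continuousM; [exact: cF|exact: IH].
Qed.

Lemma continuous_sqn n : continuous (@sqn R n).
Proof.
apply: continuous_bigsum => i; under eq_fun do rewrite expr2.
by move=> x; apply: continuousM; exact: coord_continuous.
Qed.

(** The determinant is a polynomial in the entries; its continuity makes invertibility an open
    condition. *)
Lemma continuous_det n : continuous (fun v : 'rV[R]_(n * n) => \det (vec_mx v)).
Proof.
apply: continuous_bigsum => s.
have cp : continuous (fun v : 'rV[R]_(n * n) => \prod_i vec_mx v i (s i)).
  by apply: continuous_bigprod => i; under eq_fun do rewrite mxE;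
    exact: coord_continuous.
by move=> v; apply: (continuousM (@cst_continuous _ _ _ _) (cp v)).
Qed.

Lemma open_sqn_lt n (r : R) : open [set x | @sqn R n x < r].
Proof.
apply: (@open_comp _ _ (@sqn R n) [set y | y < r]); last exact: open_lt.
by move=> x _; exact: continuous_sqn.
Qed.

Lemma lebesgue_rV_sqball_gt0 n (r : R) : 0 < r -> (0 < mu n (sqball r))%E.
Proof.
move=> r0; apply: (@lt_le_trans _ _ (mu n [set x | sqn x < r])).
  apply: lebesgue_rV_open_gt0; first exact: open_sqn_lt.
  exists 0 => /=; rewrite /sqn big1 // => i _; by rewrite mxE expr0n.
apply: le_measure; rewrite ?inE; last by move=> x /ltW.
  by apply: sub_sigma_algebra; exact: open_sqn_lt.
exact: measurable_sqball.
Qed.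

(* Both sides of the final equation are the integral over [(x, y)] of
   [A (x + f y) && B (f y)], with [B] the unit ball: the shift of [y] by [g x]
   turns it into [A (f y) && B (f y - x)]. *)
Lemma lebesgue_rV_isometry n (f g : 'rV[R]_n -> 'rV[R]_n) (A : set 'rV[R]_n) :
  {morph f : x y / x + y} -> cancel g f -> (forall x, sqn (f x) = sqn x) ->
  measurable_fun setT f -> measurable A -> mu n (f @^-1` A) = mu n A.
Proof.
move=> fD gK fN mf mA; pose B : set 'rV[R]_n := sqball 1.
have mB : measurable B := measurable_sqball 1.
have mpre (h : 'rV[R]_n * 'rV[R]_n -> 'rV[R]_n) C :
    measurable_fun setT h -> measurable C -> measurable (h @^-1` C).
  by move=> mh mC; rewrite -[X in measurable X]setTI; exact: mh.
have mfA C : measurable C -> measurable (f @^-1` C).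
  by move=> mC; rewrite -[X in measurable X]setTI; exact: mf.
have mf2 : measurable_fun setT (fun p : 'rV[R]_n * 'rV[R]_n => f p.2).
  by apply: measurableT_comp => //; exact: measurable_snd.
have mc (h : 'rV[R]_n * 'rV[R]_n -> 'rV[R]_n) i j : measurable_fun setT h ->
    measurable_fun setT (fun p => h p i j).
  by move=> mh; apply: (measurableT_comp (measurable_coord i j)).
have mD1 : measurable [set p : 'rV[R]_n * 'rV[R]_n | A (p.1 + f p.2) /\ B (f p.2)].
  apply: measurableI; last exact: (mpre (fun p => f p.2)).
  apply: (mpre (fun p => p.1 + f p.2)) => //.
  apply: measurable_fun_matrix => i j; under eq_fun do rewrite mxE.
  by apply: measurable_funD; [apply: (mc fst);
    exact: measurable_fst|exact: (mc (fun p => f p.2))].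
have mD2 : measurable [set p : 'rV[R]_n * 'rV[R]_n | A (f p.2) /\ B (f p.2 - p.1)].
  apply: measurableI; first exact: (mpre (fun p => f p.2)).
  apply: (mpre (fun p => f p.2 - p.1)) => //.
  apply: measurable_fun_matrix => i j; under eq_fun do rewrite 2!mxE.
  by apply: measurable_funB; [exact: (mc (fun p => f p.2))|apply: (mc fst);
    exact: measurable_fst].
have E1 := fubini_slices mD1; have E2 := fubini_slices mD2.
rewrite /= in E1 E2.
have E12 x : mu n [set y | A (x + f y) /\ B (f y)] = mu n [set y | A (f y) /\ B
  (f y - x)].
  have mE : measurable [set y | A (f y) /\ B (f y - x)].
    have := measurable_xsection x mD2; rewrite /xsection /=.
    by congr (measurable _); apply/funext => y; rewrite /= in_setE.
  rewrite -(lebesgue_rV_translate (g x) mE); congr (mu n _).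
  by apply/funext => y /=; rewrite fD gK addrK addrC.
have R1 : (\int[mu n]_y mu n [set x | A (x + f y)%R /\ B (f y)] = mu n A * mu n
  B)%E.
  transitivity (\int[mu n]_y mu n [set x | (f @^-1` B) y /\ A (x + f y)%R])%E.
    by apply: eq_integral => y _; congr (mu n _); apply/seteqP; split => x [].
  rewrite (integral_measure_slices (P := fun y => [set x | A (x + f y)%R]) (c :=
    mu n A)) //.
  - by congr (_ * mu n _)%E; apply/funext => y; rewrite /B /sqball /= fN.
  - exact: mfA.
  - by move=> y _; exact: lebesgue_rV_translate.
(* For fixed [y] the slice in [x] is the ball centred at [f y], a translate of [B] by the symmetry
   [sqnN]. *)
have R2 : (\int[mu n]_y mu n [set x | A (f y) /\ B (f y - x)%R] = mu n B * mu n
  (f @^-1` A))%E.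
  rewrite (integral_measure_slices (E := f @^-1` A) (P := fun y => [set x | B (f
    y - x)%R]) (c := mu n B)) //.
    exact: mfA.
  move=> y _; rewrite -(lebesgue_rV_translate (- f y)%R mB); congr (mu n _).
  by apply/funext => x; rewrite /B /sqball /= -sqnN opprB.
have : (mu n B * mu n (f @^-1` A) = mu n B * mu n A)%E.
  rewrite -R2 -E2 [RHS]muleC -R1 -E1; apply: eq_integral => x _; exact/esym/E12.
have Boo : (mu n B < +oo)%E by exact: lebesgue_rV_sqball_lty.
have B0 : (0 < mu n B)%E := lebesgue_rV_sqball_gt0 n ltr01.
exact: mule_injl.
Qed.

End isometry_invariance.

(** * Orthogonal matrices and the Gram-Schmidt process *)

Section gram_schmidt.
Context {R : realType}.

(** Inversion is continuous off [0], and on the singleton of [0] every function is measurable,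
    whatever the default [0^-1 = 0]. *)
Lemma measurable_fun_invr d (T : measurableType d) (f : T -> R) :
  measurable_fun setT f -> measurable_fun setT (fun x => (f x)^-1).
Proof.
move=> mf; apply: (measurableT_comp (f := (fun y : R => y^-1))) => //.
rewrite -(setvU [set (0 : R)]); apply/measurable_funU => //;
  first exact: measurableC.
split; last exact: measurable_fun_set1.
apply: open_continuous_measurable_fun; first by rewrite openC; exact: closed_eq.
by move=> x /set_mem /eqP x0; exact: inv_continuous.
Qed.

Lemma measurable_fun_sqrt d (T : measurableType d) (f : T -> R) :
  measurable_fun setT f -> measurable_fun setT (fun x => Num.sqrt (f x)).
Proof.
move=> mf; apply: (measurableT_comp (f := @Num.sqrt R)) => //.
by apply: continuous_measurable_fun; exact: sqrt_continuous.
Qed.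

Lemma measurable_fun_mulmx d (T : measurableType d) m n p
    (f : T -> 'M[R]_(m, n)) (g : T -> 'M[R]_(n, p)) :
  measurable_fun setT f -> measurable_fun setT g ->
  measurable_fun setT (fun x => f x *m g x).
Proof.
move=> mf mg; apply: measurable_fun_matrix => i j; under eq_fun do rewrite mxE.
apply: measurable_sum => k; apply: measurable_funM.
  exact: (measurableT_comp (measurable_coord i k)).
exact: (measurableT_comp (measurable_coord k j)).
Qed.

Definition dot n (u v : 'rV[R]_n) : R := \sum_i u 0 i * v 0 i.

Lemma dotE n (u v : 'rV[R]_n) : dot u v = (u *m v^T) 0 0.
Proof. by rewrite mxE; apply: eq_bigr => i _; rewrite mxE. Qed.

Lemma sqnE n (u : 'rV[R]_n) : sqn u = dot u u.
Proof. by apply: eq_bigr => i _; rewrite expr2. Qed.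

Lemma dotC n (u v : 'rV[R]_n) : dot u v = dot v u.
Proof. by apply: eq_bigr => i _; rewrite mulrC. Qed.

Lemma dotDl n (u v w : 'rV[R]_n) : dot (u + v) w = dot u w + dot v w.
Proof. by rewrite !dotE mulmxDl mxE. Qed.

Lemma dotZl n a (u w : 'rV[R]_n) : dot (a *: u) w = a * dot u w.
Proof. by rewrite !dotE -scalemxAl mxE. Qed.

Lemma dotNl n (u w : 'rV[R]_n) : dot (- u) w = - dot u w.
Proof. by rewrite -scaleN1r dotZl mulN1r. Qed.

Lemma dot_suml n I (s : seq I) P (F : I -> 'rV[R]_n) w :
  dot (\sum_(i <- s | P i) F i) w = \sum_(i <- s | P i) dot (F i) w.
Proof. by rewrite dotE mulmx_suml summxE; apply: eq_bigr => i _; rewrite dotE. Qed.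

Lemma sqn_ge0 n (u : 'rV[R]_n) : 0 <= sqn u.
Proof. by apply: sumr_ge0 => i _; exact: sqr_ge0. Qed.

Lemma sqn_eq0 n (u : 'rV[R]_n) : (sqn u == 0) = (u == 0).
Proof.
apply/eqP/eqP => [u0|->]; last by rewrite /sqn big1 // => i _; rewrite mxE expr0n.
apply/rowP => i; rewrite mxE; apply/eqP; rewrite -sqrf_eq0; apply/eqP.
by move: u0; move/psumr_eq0P => -> // j _; exact: sqr_ge0.
Qed.

Lemma sqnZ n a (u : 'rV[R]_n) : sqn (a *: u) = a ^+ 2 * sqn u.
Proof. by rewrite /sqn mulr_sumr; apply: eq_bigr => i _; rewrite mxE exprMn. Qed.

Lemma l2normE n (u : 'rV[R]_n) : l2norm u = Num.sqrt (sqn u). Proof. by []. Qed.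

Lemma l2norm_eq1 n (u : 'rV[R]_n) : l2norm u = 1 <-> sqn u = 1.
Proof.
rewrite l2normE; split => [u1|->]; last exact: sqrtr1.
by rewrite -(sqr_sqrtr (sqn_ge0 u)) u1 expr1n.
Qed.

Definition orthogonal_mx n (Q : 'M[R]_n) := Q *m Q^T = 1%:M.

Lemma orthogonal_mxT n (Q : 'M[R]_n) : orthogonal_mx Q -> orthogonal_mx Q^T.
Proof. by rewrite /orthogonal_mx trmxK => /mulmx1C. Qed.

Lemma dot_orthogonal n (Q : 'M[R]_n) u v :
  orthogonal_mx Q -> dot (u *m Q) (v *m Q) = dot u v.
Proof. by move=> QQ; rewrite !dotE trmx_mul mulmxA -(mulmxA u) QQ mulmx1. Qed.

Lemma sqn_orthogonal n (Q : 'M[R]_n) u : orthogonal_mx Q -> sqn (u *m Q) = sqn u.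
Proof. by move=> QQ; rewrite !sqnE dot_orthogonal. Qed.

(* If [u != v], reflect in the hyperplane orthogonal to [u - v]. *)
Lemma orthogonal_transitive n (u v : 'rV[R]_n) : sqn u = 1 -> sqn v = 1 ->
  exists2 Q, orthogonal_mx Q & u *m Q = v.
Proof.
move=> u1 v1; have [<-|uv] := eqVneq u v.
  by exists 1%:M; rewrite /orthogonal_mx ?trmx1 mulmx1.
pose w := u - v; have w0 : sqn w != 0 by rewrite sqn_eq0 subr_eq0.
have dw x : x *m w^T = (dot x w)%:M by rewrite [LHS]mx11_scalar -dotE.
exists (1%:M - (2 / sqn w) *: (w^T *m w)).
  set c := 2 / sqn w; set A := w^T *m w.
  have AA : A *m A = sqn w *: A.
    by rewrite mulmxA -(mulmxA w^T) dw -sqnE mul_mx_scalar -scalemxAl.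
  have HT : (1%:M - c *: A)^T = 1%:M - c *: A.
    by rewrite raddfB /= linearZ /= trmx_mul trmxK tr_scalar_mx.
  rewrite /orthogonal_mx HT mulmxBr mulmx1 mulmxBl mul1mx -scalemxAl -scalemxAr
    AA !scalerA.
  (* In the square of the reflection, the quadratic term in [A] thus cancels the two linear ones. *)
  have -> : c * c * sqn w = c + c by rewrite -mulrA /c divfK //; ring.
  by rewrite scalerDl opprD opprK addKr subrK.
rewrite mulmxBr mulmx1 -scalemxAr mulmxA dw mul_scalar_mx scalerA.
(* For unit vectors [sqn (u - v) = 2 * dot u (u - v)], so the reflection subtracts exactly [w] from
   [u]. *)
have -> : 2 / sqn w * dot u w = 1.
  have dwE : sqn w = 2 * dot u w.
    rewrite sqnE /w dotDl dotNl ![dot _ (u - v)]dotC !dotDl !dotNl -!sqnE u1 v1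
      (dotC v u).
    by ring.
  by rewrite mulrAC -dwE divff.
by rewrite scale1r /w opprB addrC subrK.
Qed.

(** Removes from row [k] its projection onto the earlier rows, once these are pairwise orthogonal
    and each of them is a unit vector or zero. *)
Definition gs_row n (k : 'I_n) (P : 'M[R]_n) : 'rV[R]_n :=
  row k P - \sum_(j < n | (j < k)%N) dot (row k P) (row j P) *: row j P.

Definition gs_step n (k : 'I_n) (P : 'M[R]_n) : 'M[R]_n :=
  \matrix_i (if i == k then (l2norm (gs_row k P))^-1 *: gs_row k P else row i P).

(* Gram-Schmidt on the first [k] rows; as [0^-1 = 0], a row that depends on the
   previous ones becomes [0]. *)
Definition gs n k (M : 'M[R]_n) : 'M[R]_n :=
  foldl (fun P i => gs_step i P) M (take k (enum 'I_n)).

Lemma gs0 n (M : 'M[R]_n) : gs 0 M = M.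
Proof. by rewrite /gs take0. Qed.

Lemma gsS n (M : 'M[R]_n) (k : 'I_n) : gs k.+1 M = gs_step k (gs k M).
Proof.
rewrite /gs (take_nth k) ?size_enum_ord // -cats1 foldl_cat /=.
by congr gs_step; apply: val_inj; rewrite /= nth_enum_ord.
Qed.

Lemma gs_ind n (M : 'M[R]_n) (Pr : nat -> 'M[R]_n -> Prop) :
  Pr 0 M -> (forall (k : 'I_n) P, Pr k P -> Pr k.+1 (gs_step k P)) ->
  forall k, (k <= n)%N -> Pr k (gs k M).
Proof.
move=> P0 PS; elim=> [|k IH] kn; first by rewrite gs0.
by rewrite (gsS _ (Ordinal kn)); apply: (PS (Ordinal kn)); apply: IH; exact: ltnW.
Qed.

(** The coefficients are dot products, which [Q] preserves; the equivariance of the whole process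
    rests on this. *)
Lemma gs_row_mulmx n (k : 'I_n) (P Q : 'M[R]_n) :
  orthogonal_mx Q -> gs_row k (P *m Q) = gs_row k P *m Q.
Proof.
move=> QQ; rewrite /gs_row mulmxBl row_mul mulmx_suml; congr (_ - _).
by apply: eq_bigr => j _; rewrite !row_mul dot_orthogonal // scalemxAl.
Qed.

Lemma gs_step_mulmx n (k : 'I_n) (P Q : 'M[R]_n) :
  orthogonal_mx Q -> gs_step k (P *m Q) = gs_step k P *m Q.
Proof.
move=> QQ; apply/row_matrixP => i; rewrite row_mul !rowK; case: ifP => _;
  last by rewrite row_mul.
by rewrite gs_row_mulmx // scalemxAl !l2normE sqn_orthogonal.
Qed.

Lemma gs_mulmx n k (M Q : 'M[R]_n) : (k <= n)%N ->
  orthogonal_mx Q -> gs k (M *m Q) = gs k M *m Q.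
Proof.
move=> kn QQ; elim: k kn => [|k IH] kn; first by rewrite !gs0.
by rewrite !(gsS _ (Ordinal kn)) IH ?gs_step_mulmx // ltnW.
Qed.

Lemma measurable_dot d (T : measurableType d) n (f g : T -> 'rV[R]_n) :
  measurable_fun setT f -> measurable_fun setT g ->
  measurable_fun setT (fun x => dot (f x) (g x)).
Proof.
move=> mf mg; apply: measurable_sum => i; apply: measurable_funM.
  exact: (measurableT_comp (measurable_coord 0 i)).
exact: (measurableT_comp (measurable_coord 0 i)).
Qed.

Lemma measurable_gs_step n (k : 'I_n) d (T : measurableType d) (g : T -> 'M[R]_n) :
  measurable_fun setT g -> measurable_fun setT (fun x => gs_step k (g x)).
Proof.
move=> mg.
have mrow i : measurable_fun setT (fun x => row i (g x)).
  apply: measurable_fun_matrix => i' j; under eq_fun do rewrite mxE.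
  exact: (measurableT_comp (measurable_coord i j)).
have mr : measurable_fun setT (fun x => gs_row k (g x)).
  apply: measurable_fun_matrix => i' j; rewrite ord1.
  under eq_fun do rewrite /gs_row mxE [X in _ + X]mxE summxE.
  apply: measurable_funB; first exact: (measurableT_comp (measurable_coord 0 j)).
  rewrite (_ : (fun x => _) = fun x => \sum_(i < n)
     (if (i < k)%N then dot (row k (g x)) (row i (g x)) * row i (g x) 0 j else
       0)); last first.
    apply/funext => x; rewrite [LHS]big_mkcond.
    by apply: eq_bigr => i _; case: ifP => // _; rewrite mxE.
  apply: measurable_sum => i; case: (i < k)%N => //.
  apply: measurable_funM; first exact: measurable_dot.
  exact: (measurableT_comp (measurable_coord 0 j)).
have mrj j : measurable_fun setT (fun x => gs_row k (g x) 0 j).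
  exact: (measurableT_comp (measurable_coord 0 j)).
apply: measurable_fun_matrix => i j; under eq_fun do rewrite mxE.
case: (i == k) => /=; last exact: (measurableT_comp (measurable_coord 0 j) (mrow
  i)).
under eq_fun do rewrite mxE.
apply: measurable_funM => //.
apply: measurable_fun_invr; apply: measurable_fun_sqrt.
exact: (measurableT_comp (@measurable_sqn R n)).
Qed.

Lemma measurable_gs n k d (T : measurableType d) (f : T -> 'M[R]_n) : (k <= n)%N ->
  measurable_fun setT f -> measurable_fun setT (fun x => gs k (f x)).
Proof.
move=> kn mf; elim: k kn => [|k IH] kn.
  by under eq_fun do rewrite gs0.
under eq_fun do rewrite (gsS _ (Ordinal kn)).
by apply: measurable_gs_step; exact: IH (ltnW kn).
Qed.

(** The invariant [good] tolerates zero rows. They are excluded only at the end: the row space of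
    [M] is never lost, so the final matrix is invertible. *)
Lemma gs_orthogonal n (M : 'M[R]_n) : \det M != 0 -> orthogonal_mx (gs n M).
Proof.
move=> M0.
pose good k (P : 'M[R]_n) := [/\ (M <= P)%MS,
  forall i : 'I_n, (i < k)%N -> row i P = 0 \/ dot (row i P) (row i P) = 1 &
  forall i j : 'I_n, (i < k)%N -> (j < k)%N -> i != j -> dot (row i P) (row j P)
    = 0].
suff [MQ Q1 Q0] : good n (gs n M).
  have Qu : gs n M \in unitmx.
    rewrite -row_full_unit -sub1mx; apply: submx_trans MQ.
    by rewrite sub1mx row_full_unit unitmxE unitfE.
  apply/matrixP => i j; rewrite !mxE -[LHS]/(\sum_k _).
  have -> : \sum_k gs n M i k * (gs n M)^T k j = dot (row i (gs n M)) (row j (gs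
    n M)).
    by apply: eq_bigr => k _; rewrite !mxE.
  have [<-|ij] := eqVneq i j; last exact: Q0.
  have [r0|//] := Q1 i (ltn_ord i).
  (* A zero row would produce a zero row in the identity matrix. *)
  have : row i (gs n M) *m invmx (gs n M) = 0 by rewrite r0 mul0mx.
  rewrite -row_mul mulmxV // => /rowP/(_ i); rewrite !mxE eqxx => /eqP.
  by rewrite oner_eq0.
apply: gs_ind => // k P [MP P1 P0].
pose r := gs_row k P.
have rowS i : row i (gs_step k P) = if i == k then (l2norm r)^-1 *: r else row i
  P by rewrite rowK.
(* By orthogonality only the term [j] of the projection survives; it cancels
   [dot (row k P) (row j P)] if row [j] is a unit vector, and both vanish if row [j] is zero. *)
have rdot (j : 'I_n) : (j < k)%N -> dot r (row j P) = 0.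
  move=> jk; rewrite /r /gs_row dotDl dotNl dot_suml (bigD1 j) //= big1 => [|i
    /andP[ik ij]].
    rewrite dotZl addr0; have [->|->] := P1 j jk; last by rewrite mulr1 subrr.
    by rewrite !(dotC _ 0) !dotE !mul0mx mxE mul0r subrr.
  by rewrite dotZl (P0 i j) ?mulr0.
split.
- apply: submx_trans MP _; apply/row_subP => i.
  have [ik|ik] := eqVneq i k; last by rewrite -[row i P](_ : row i (gs_step k P)
    = _) ?row_sub // rowS (negbTE ik).
  (* The old row [k] is recovered from the earlier rows and [r], which is zero or a multiple of the
     new row [k]. *)
  have -> : row i P = r + \sum_(j < n | (j < k)%N) dot (row k P) (row j P) *: row
    j P.
    by rewrite ik /r /gs_row subrK.
  apply: addmx_sub.
    have [->|r0] := eqVneq r 0; first exact: sub0mx.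
    have -> : r = l2norm r *: row k (gs_step k P).
      rewrite rowS eqxx scalerA divff ?scale1r // l2normE sqrtr_eq0 -ltNge.
      by rewrite lt_def sqn_eq0 r0 sqn_ge0.
    exact: scalemx_sub (row_sub _ _).
  apply: summx_sub => j jk; apply: scalemx_sub.
  rewrite (_ : row j P = row j (gs_step k P)) ?row_sub // rowS ifN //.
  by apply: contraTneq jk => ->; rewrite ltnn.
- move=> i; rewrite ltnS rowS; case: eqVneq => [_ _|ik ilek]; last first.
    by apply: P1; rewrite ltn_neqAle ilek andbT.
  have [->|r0] := eqVneq r 0; [left|right]; first by rewrite scaler0.
  rewrite -sqnE sqnZ exprVn l2normE sqr_sqrtr ?sqn_ge0 // mulVf //.
  by rewrite sqn_eq0.
- have sep (i j : 'I_n) : (j < k)%N -> i = k -> dot (row i (gs_step k P)) (row j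
  (gs_step k P)) = 0.
    move=> jk ->; rewrite !rowS eqxx ifN ?dotZl ?rdot ?mulr0 //.
    by apply: contraTneq jk => ->; rewrite ltnn.
  move=> i j; rewrite !ltnS (leq_eqVlt i) (leq_eqVlt j).
  move=> /orP[/eqP/val_inj ik|ik] /orP[/eqP/val_inj jk|jk] ij.
  + by rewrite ik jk eqxx in ij.
  + exact: sep.
  + by rewrite dotC; exact: sep.
  + rewrite !rowS !ifN; first exact: P0.
      by apply: contraTneq jk => ->; rewrite ltnn.
    by apply: contraTneq ik => ->; rewrite ltnn.
Qed.

End gram_schmidt.

(** * Triangle-free edge selections, cones, and the averaging argument *)

Section averaging.
Context {R : realType}.
Local Notation mu n := (@lebesgue_rV R n).
Local Opaque lebesgue_rV.

(** The edges satisfying [P], on all vertices of [G], form a competitor in the maximum that defines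
    [tbar]. *)
Lemma leq_tbar (V : choiceType) (G : digraph V) (P : pred (V * V)) :
  (forall x y z, P (x, y) -> P (y, z) -> P (z, x) -> False) ->
  (\sum_(e <- edges G) P e <= tbar G)%N.
Proof.
move=> Ptri; pose E := [fset e in [seq e <- edges G | P e]]%fset.
have inE' e : (e \in E) = P e && (e \in edges G) by rewrite in_fset_ mem_filter.
pose H := @Digraph V (vertices G) E
  (fun x y xy => edges_vertices (andP (etrans (esym (inE' (x, y))) xy)).2)
  (fun x y xy => edges_neq (andP (etrans (esym (inE' (x, y))) xy)).2).
have -> : (\sum_(e <- edges G) P e = #|` E|)%N.
  rewrite card_fseq undup_id ?filter_uniq ?fset_uniq // size_filter -sum1_count.
  by rewrite [RHS]big_mkcond; apply: eq_bigr => e _; case: (P e).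
have EG : (#|` E| < #|` edges G|.+1)%N.
  by rewrite ltnS; apply/fsubset_leq_card/fsubsetP => e; rewrite inE' => /andP[].
(* The edge count has to appear as an index of the bounded maximum. *)
rewrite /tbar -[X in (X <= _)%N]/(nat_of_ord (Ordinal EG)).
apply: (@leq_bigmax_cond _ _ (fun k : 'I_ _ => nat_of_ord k)).
apply/asboolP; exists H; split => //.
  split; first exact: fsubset_refl.
  by apply/fsubsetP => e; rewrite inE' => /andP[].
case=> x [y [z [_ []]]]; rewrite /= !inE' => /andP[xy _] /andP[yz _] /andP[zx _].
exact: Ptri xy yz zx.
Qed.

Lemma l2norm_ge0 n (x : 'rV[R]_n) : 0 <= l2norm x.
Proof. exact: sqrtr_ge0. Qed.

Lemma l2norm_sqr n (x : 'rV[R]_n) : l2norm x ^+ 2 = sqn x.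
Proof. by rewrite l2normE sqr_sqrtr // sqn_ge0. Qed.

Lemma l2norm_gt0 n (x : 'rV[R]_n) : (0 < l2norm x) = (0 < sqn x).
Proof. by rewrite l2normE sqrtr_gt0. Qed.

Lemma l2norm_le1 n (x : 'rV[R]_n) : (l2norm x <= 1) = (sqn x <= 1).
Proof. by rewrite -l2norm_sqr expr_le1 // l2norm_ge0. Qed.

Lemma l2normZ n a (x : 'rV[R]_n) : 0 <= a -> l2norm (a *: x) = a * l2norm x.
Proof.
by move=> a0; rewrite !l2normE sqnZ sqrtrM ?sqr_ge0 // sqrtr_sqr ger0_norm.
Qed.

(** As [S] lies on the sphere, [t] and [u] must be the norm and the direction of [x]. This trades
    the existential for measurable conditions. *)
Lemma coneE n (S : set 'rV[R]_n) : S `<=` @sphere R n ->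
  cone S = [set x | 0 < sqn x <= 1 /\ S ((l2norm x)^-1 *: x)].
Proof.
move=> sS; apply/seteqP; split => [x [t [u Su [/andP[t0 t1] ->]]]|x [/andP[x0 x1]
  Sx]].
  have u1 : l2norm u = 1 := sS _ Su.
  have tu : l2norm (t *: u) = t by rewrite l2normZ ?u1 ?mulr1 // ltW.
  rewrite /= -l2norm_gt0 -l2norm_le1 tu t0 t1; split => //.
  by rewrite scalerA mulVf ?scale1r // gt_eqF.
exists (l2norm x), ((l2norm x)^-1 *: x) => //;
  rewrite l2norm_gt0 l2norm_le1 x0 x1; split => //.
by rewrite scalerA divff ?scale1r // gt_eqF // l2norm_gt0.
Qed.

Lemma normalize_sphere n (x : 'rV[R]_n) : 0 < sqn x -> @sphere R n ((l2norm x)^-1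
  *: x).
Proof.
move=> x0; rewrite /sphere /= l2normZ ?invr_ge0 ?l2norm_ge0 // mulVf //.
by rewrite gt_eqF // l2norm_gt0.
Qed.

Lemma cone_sphereE n : cone (@sphere R n) = [set x | 0 < sqn x <= 1].
Proof.
rewrite coneE //; apply/seteqP; split => x [] // x0; split => //.
by apply: normalize_sphere; case/andP: x0.
Qed.

Lemma measurable_sqn_itv n (i : interval R) : measurable [set x : 'rV[R]_n | sqn
  x \in i].
Proof.
rewrite -[X in measurable X]setTI.
exact: (@measurable_sqn R n measurableT [set` i]).
Qed.

Lemma measurable_punctured n : measurable [set x : 'rV[R]_n | 0 < sqn x <= 1].
Proof.
have := @measurable_sqn_itv n `]0, 1].
by congr (measurable _); apply/funext => x; rewrite /= in_itv.
Qed.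

Lemma measurable_cone n (S : set 'rV[R]_n) : S `<=` @sphere R n -> measurable S ->
  measurable (cone S).
Proof.
move=> sS mS; rewrite coneE //; apply: measurableI.
  exact: measurable_punctured.
rewrite -[X in measurable X]setTI.
apply: (_ : measurable_fun setT (fun x : 'rV[R]_n => (l2norm x)^-1 *: x)) => //.
apply: measurable_fun_matrix => i j; under eq_fun do rewrite mxE.
apply: measurable_funM; last exact: measurable_coord.
by apply: measurable_fun_invr; apply: measurable_fun_sqrt; exact: measurable_sqn.
Qed.

(** * The random frame and its rotation invariance *)

Section random_frame.
Context (d : nat).

(* The transpose makes [x *m gs_frame] of [M *m Q] equal to [x *m Q^T *m gs_frame]
   of [M]. *)
Definition gs_frame (v : 'rV[R]_(d * d)) : 'M[R]_d := (gs d (vec_mx v))^T.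

(* The bound makes the measure finite; it is met by the identity matrix, whose
   [sqn] is [d]. *)
Definition frames : set 'rV[R]_(d * d) :=
  [set v | sqn v < d.+1%:R /\ \det (vec_mx v) != 0].

Lemma measurable_gs_frame : measurable_fun setT gs_frame.
Proof.
have mg : measurable_fun setT (fun v : 'rV[R]_(d * d) => gs d (vec_mx v)).
  apply: measurable_gs => //; apply: measurable_fun_matrix => i j.
  by under eq_fun do rewrite mxE; exact: measurable_coord.
apply: measurable_fun_matrix => i j; under eq_fun do rewrite mxE.
exact: (measurableT_comp (measurable_coord j i)).
Qed.

Lemma gs_frame_orthogonal v : frames v -> orthogonal_mx (gs_frame v).
Proof. by move=> [_ v0]; apply: orthogonal_mxT; exact: gs_orthogonal. Qed.

Lemma open_frames : open frames.
Proof.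
apply: openI; first exact: open_sqn_lt.
apply: (@open_comp _ _ (fun v : 'rV[R]_(d * d) => \det (vec_mx v)) [set y | y !=
  0]).
  by move=> v _; exact: continuous_det.
exact: open_neq.
Qed.

Lemma measurable_frames : measurable frames.
Proof. by apply: sub_sigma_algebra; exact: open_frames. Qed.

(** Lets right multiplication of a flattened matrix be checked to be an isometry row by row. *)
Lemma sqn_mxvec (M : 'M[R]_d) : sqn (mxvec M) = \sum_i sqn (row i M).
Proof.
rewrite /sqn pair_bigA /= (reindex _ (curry_mxvec_bij _ _)) /=.
by apply: eq_bigr => -[i j] _; rewrite mxvecE mxE.
Qed.

Lemma lebesgue_frames_gt0 : (0 < mu (d * d) frames)%E.
Proof.
apply: lebesgue_rV_open_gt0; first exact: open_frames.
exists (mxvec 1%:M); split; last by rewrite mxvecK det1 oner_neq0.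
rewrite sqn_mxvec (eq_bigr (fun=> 1)) ?sumr_const ?card_ord ?ltr_nat // => i _.
rewrite /sqn (bigD1 i) //= big1 => [|j ji]; first by rewrite !mxE eqxx expr1n addr0.
by rewrite !mxE eq_sym (negbTE ji) expr0n.
Qed.

Lemma lebesgue_frames_lty : (mu (d * d) frames < +oo)%E.
Proof.
apply: (@le_lt_trans _ _ (mu (d * d) (sqball d.+1%:R))).
  apply: le_measure; rewrite ?inE; [exact: measurable_frames|exact:
    measurable_sqball|].
  by move=> v [/ltW].
by apply: lebesgue_rV_sqball_lty; exact: ler0n.
Qed.

Lemma measurable_gs_frame_mem (C : set 'rV[R]_d) : measurable C ->
  measurable [set p : 'rV[R]_(d * d) * 'rV[R]_d | C (p.2 *m gs_frame p.1)].
Proof.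
move=> mC; rewrite -[X in measurable X]setTI.
apply: (_ : measurable_fun setT
  (fun p : 'rV[R]_(d * d) * 'rV[R]_d => p.2 *m gs_frame p.1)) => //.
apply: measurable_fun_mulmx; first exact: measurable_snd.
by apply: (measurableT_comp measurable_gs_frame); exact: measurable_fst.
Qed.

Lemma measurable_gs_frame_hit (C : set 'rV[R]_d) x : measurable C ->
  measurable [set v | frames v /\ C (x *m gs_frame v)].
Proof.
move=> mC; apply: measurableI; first exact: measurable_frames.
have := measurable_ysection x (measurable_gs_frame_mem mC).
by congr (measurable _); apply/funext => v; rewrite /ysection /= in_setE.
Qed.

(* Multiplying all rows of [M] by [Q] multiplies its Gram-Schmidt frame by [Q]
   and is an isometry of the space of matrices. *)
Lemma lebesgue_gs_frame_hit (C : set 'rV[R]_d) x y : measurable C ->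
  sqn x = 1 -> sqn y = 1 ->
  mu (d * d) [set v | frames v /\ C (x *m gs_frame v)] =
  mu (d * d) [set v | frames v /\ C (y *m gs_frame v)].
Proof.
move=> mC x1 y1; have [Q QQ <-] := orthogonal_transitive x1 y1.
have QT := orthogonal_mxT QQ.
pose f (v : 'rV[R]_(d * d)) := mxvec (vec_mx v *m Q^T).
pose g (v : 'rV[R]_(d * d)) := mxvec (vec_mx v *m Q).
have fN v : sqn (f v) = sqn v.
  rewrite -[in RHS](vec_mxK v) !sqn_mxvec; apply: eq_bigr => i _.
  by rewrite row_mul sqn_orthogonal.
have mE := measurable_gs_frame_hit x mC.
rewrite -(@lebesgue_rV_isometry R (d * d) f g _ _ _ fN _ mE).
- congr (mu _ _); apply/funext => v; rewrite /frames /gs_frame /= fN /f mxvecK.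
  rewrite gs_mulmx // trmx_mul trmxK mulmxA det_mulmx mulf_eq0 negb_or.
  suff -> : \det Q^T != 0 by rewrite andbT.
  by rewrite -unitfE -unitmxE; case: (mulmx1_unit QT).
- by move=> u v; rewrite /f linearD /= mulmxDl linearD.
- by move=> v; rewrite /f /g mxvecK -mulmxA QQ mulmx1 vec_mxK.
- apply: measurable_fun_matrix => i j; rewrite ord1.
  case/mxvec_indexP: j => k l; under eq_fun do rewrite mxvecE mxE.
  apply: measurable_sum => m; apply: measurable_funM => //.
  by under eq_fun do rewrite mxE; exact: measurable_coord.
Qed.

(** Both sides measure the set [D] of pairs [(v, x)]. For a fixed frame, [x] is moved by an
    isometry, so the slice is as large as [cone S]; for fixed [x], the slice depends only on the
    direction of [x] and is as large as for [e]. *)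
Lemma lebesgue_cone_gs_frame (S : set 'rV[R]_d) e :
  S `<=` @sphere R d -> measurable S -> sqn e = 1 ->
  (mu d (cone S) * mu (d * d) frames =
   mu (d * d) [set v | frames v /\ cone S (e *m gs_frame v)] * mu d (cone
     (@sphere R d)))%E.
Proof.
move=> sS mS e1; have mC := measurable_cone sS mS.
have mBall : measurable (cone (@sphere R d)).
  by rewrite cone_sphereE; exact: measurable_punctured.
pose D := [set p : 'rV[R]_(d * d) * 'rV[R]_d |
  [/\ frames p.1, cone (@sphere R d) p.2 & cone S (p.2 *m gs_frame p.1)]].
have mD : measurable D.
  rewrite (_ : D = (frames `*` cone (@sphere R d)) `&`
      [set p | cone S (p.2 *m gs_frame p.1)]); last first.
    by apply/seteqP; split => [p []|p [[]]].
  apply: measurableI; last exact: measurable_gs_frame_mem.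
  by apply: measurableX => //; exact: measurable_frames.
(* The frame preserves the norm, so an image in [cone S] already puts [x] in the punctured unit
   ball. *)
have hitP v x : frames v -> (cone (@sphere R d) x /\ cone S (x *m gs_frame v)) <->
    cone S (x *m gs_frame v).
  move=> Bv; split=> [[]//|Cx]; split => //.
  move: Cx; rewrite coneE // cone_sphereE => -[+ _].
  by rewrite sqn_orthogonal //; exact: gs_frame_orthogonal.
have -> : (mu d (cone S) * mu (d * d) frames =
    \int[mu (d * d)]_v mu d [set x | D (v, x)])%E.
  pose P v := [set x : 'rV[R]_d | cone (@sphere R d) x /\ cone S (x *m gs_frame v)].
  transitivity (\int[mu (d * d)]_v mu d [set x | frames v /\ P v x])%E; last first.
    apply: eq_integral => v _; congr (mu d _).
    by apply/seteqP; split => x; rewrite /D /P /=; [case=> ? []|case].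
  rewrite (integral_measure_slices (c := mu d (cone S))) //;
    first exact: measurable_frames.
  move=> v Bv; have WW := gs_frame_orthogonal Bv.
  rewrite -(@lebesgue_rV_isometry R d (mulmxr (gs_frame v)) (mulmxr (gs_frame
    v)^T) _ _ _ _ _ mC).
  - by congr (mu d _); apply/funext => x; apply/propext; exact: hitP.
  - by move=> x y; exact: mulmxDl.
  - by move=> x; rewrite /= -mulmxA (mulmx1C WW) mulmx1.
  - by move=> x; exact: sqn_orthogonal.
  - apply: measurable_fun_matrix => i j; under eq_fun do rewrite mxE.
    by apply: measurable_sum => k; apply: measurable_funM => //;
      exact: measurable_coord.
rewrite fubini_slices //.
pose P x := [set v | frames v /\ cone S (x *m gs_frame v)].
transitivity (\int[mu d]_x mu (d * d) [set v | cone (@sphere R d) x /\ P x v])%E.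
  apply: eq_integral => x _; congr (mu _ _).
  by apply/seteqP; split => v; rewrite /D /P /=; [case=> a b c|case=> b [a c]].
rewrite (integral_measure_slices (c := mu (d * d) (P e))) //.
rewrite cone_sphereE => x /= /andP[x0 x1].
(* Rotation invariance compares unit vectors, hence the normalisation; with [sqn x] in []0, 1]], [x]
   and its direction are sent into [cone S] by the same frames. *)
rewrite (@lebesgue_gs_frame_hit _ e ((l2norm x)^-1 *: x)) //; last first.
  by apply/l2norm_eq1; exact: normalize_sphere.
congr (mu _ _); apply/funext => v; apply/propext.
rewrite /P /= coneE //=.
suff h : frames v -> (0 < sqn (x *m gs_frame v) <= 1 /\
     S ((l2norm (x *m gs_frame v))^-1 *: (x *m gs_frame v)))
   <-> (0 < sqn ((l2norm x)^-1 *: x *m gs_frame v) <= 1 /\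
     S ((l2norm ((l2norm x)^-1 *: x *m gs_frame v))^-1 *:
        ((l2norm x)^-1 *: x *m gs_frame v))).
  by split=> -[Bv] /(h Bv).
move=> /gs_frame_orthogonal WW.
have u1 := normalize_sphere x0; have /l2norm_eq1 u2 := u1.
rewrite !l2normE !sqn_orthogonal // -!l2normE x0 x1 u2 u1 invr1 scale1r ltr01
  lexx /=.
by rewrite scalemxAl.
Qed.
End random_frame.

(* By delta-freeness, each frame sends at most [tbar G] edges into [S]; integrate
   this bound over all frames. *)
Lemma sum_lebesgue_hits (d : nat) (G : digraph 'rV[R]_d) (S : set 'rV[R]_d) :
  unit_distance G -> S `<=` @sphere R d -> measurable S -> delta_free S ->
  (\sum_(e <- edges G) mu (d * d)
     [set v | frames v /\ cone S ((e.1 - e.2) *m gs_frame v)]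
   <= (tbar G)%:R%:E * mu (d * d) (@frames d))%E.
Proof.
move=> uG sS mS dS; have mC := measurable_cone sS mS.
pose E (e : 'rV[R]_d * 'rV[R]_d) :=
  [set v : 'rV[R]_(d * d) | frames v /\ cone S ((e.1 - e.2) *m gs_frame v)].
have mE e : measurable (E e) by exact: measurable_gs_frame_hit.
have mI e : measurable_fun setT (fun v => (\1_(E e) v)%:E : \bar R).
  by apply/measurable_EFinP; exact: measurable_indic.
rewrite (eq_bigr (fun e => \int[mu (d * d)]_v (\1_(E e) v)%:E)%E); last first.
  by move=> e _; rewrite integral_indic // setIT.
rewrite -ge0_integral_sum //.
rewrite -integral_cst; last exact: (@measurable_frames d).
rewrite [leRHS]integral_mkcond.
apply: ge0_le_integral => //.
- by move=> v _; apply: sume_ge0 => e _.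
- exact: emeasurable_sum.
- by apply/(measurable_restrictT _ (@measurable_frames d)); exact: measurable_cst.
move=> v _; rewrite patchE; case: ifPn => [|]; last first.
  rewrite notin_setE => nv; rewrite big1 // => e _.
  by rewrite indicE memNset // => -[].
rewrite inE => Bv; have WW := gs_frame_orthogonal Bv.
rewrite sumEFin lee_fin.
pose kept (e : 'rV[R]_d * 'rV[R]_d) := `[< S ((e.1 - e.2) *m gs_frame v) >].
rewrite (eq_big_seq (fun e => (kept e : nat)%:R)); last first.
  move=> [x y] xy; rewrite indicE; congr ((nat_of_bool _)%:R).
  have N1 : l2norm ((x - y) *m gs_frame v) = 1.
    by apply/l2norm_eq1; rewrite sqn_orthogonal //; apply/l2norm_eq1; exact: uG.
  (* On vectors of norm [1], [cone S] and [S] agree. *)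
  have coneS : cone S ((x - y) *m gs_frame v) <-> S ((x - y) *m gs_frame v).
    rewrite coneE //= N1 invr1 scale1r; move/l2norm_eq1 : N1 => ->.
    by rewrite ltr01 lexx; split=> [[]|].
  apply/idP/asboolP => /= [|Sxy]; first by rewrite inE => -[_ /coneS].
  by rewrite inE; split => //; exact/coneS.
rewrite -natr_sum ler_nat; apply: leq_tbar => x y z /asboolP Sxy /asboolP Syz
  /asboolP Szx.
(* The differences around a triangle sum to zero, and the frame acts linearly. *)
apply: dS; exists ((x - y) *m gs_frame v), ((y - z) *m gs_frame v), ((z - x) *m
  gs_frame v).
split => //; by rewrite -!mulmxDl !addrA !subrK subrr mul0mx.
Qed.

(** Here [c], [b], [f] stand for the volumes of [cone S], the punctured unit ball and [frames], and
    [h] for that of the frames sending a fixed unit vector into [S]. Then [c / b = h / f], and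
    [size s] copies of [h] fit below [t * f]. *)
Lemma ratio_bound (I : Type) (s : seq I) (d t : nat) (c b f h : \bar R) :
  (0 < d)%N -> (0 < size s)%N ->
  c \is a fin_num -> h \is a fin_num -> (0 < b < +oo)%E -> (0 < f < +oo)%E ->
  (c * f = h * b)%E -> (\sum_(i <- s) h <= t%:R%:E * f)%E ->
  (d%:R%:E * c / (d%:R%:E * b) <= (t%:R / (size s)%:R)%:E)%E.
Proof.
move=> d0 s0; case: c => [c| |] // _; case: h => [h| |] // _.
case: b => [b| |] //=; last by rewrite ltxx andbF.
case: f => [f| |] //=; last by rewrite ltxx !andbF.
rewrite !lte_fin => /andP[b0 _] /andP[f0 _].
rewrite -!EFinM => -[cf]; rewrite sumEFin big_const_seq count_predT iter_addr_0
  lee_fin => hf.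
have d0' : 0 < d%:R :> R by rewrite ltr0n.
have s0' : 0 < (size s)%:R :> R by rewrite ltr0n.
rewrite inver gt_eqF ?mulr_gt0 // -EFinM lee_fin.
rewrite -mulf_div divff ?gt_eqF // mul1r ler_pdivrMr // mulrAC ler_pdivlMr //.
rewrite -(ler_pM2r f0) mulrAC cf -[leRHS]mulrAC -[leLHS]mulrA [b * _]mulrC mulrA.
by rewrite ler_pM2r // mulr_natr.
Qed.

Lemma sphere_measure_le (d : nat) (G : digraph 'rV[R]_d) (S : set 'rV[R]_d) :
  (0 < d)%N -> unit_distance G -> (0 < #|` edges G|)%N ->
  S `<=` @sphere R d -> measurable S -> delta_free S ->
  (sphere_measure S <= ((tbar G)%:R / #|` edges G|%:R)%:E)%E.
Proof.
move=> d0 uG G0 sS mS dS.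
pose e0 : 'rV[R]_d := delta_mx 0 (Ordinal d0).
have e01 : sqn e0 = 1.
  rewrite /sqn (bigD1 (Ordinal d0)) //= big1 => [|i i0];
    first by rewrite mxE !eqxx expr1n addr0.
  by rewrite mxE (negbTE i0) andbF expr0n.
have mC := measurable_cone sS mS.
have mBall : measurable (cone (@sphere R d)) by rewrite cone_sphereE;
  exact: measurable_punctured.
have mE := measurable_gs_frame_hit e0 mC.
have C1 := lebesgue_cone_gs_frame sS mS e01.
have C2 := sum_lebesgue_hits uG sS mS dS.
(* Edge differences are unit vectors, so every term equals the one for the reference direction
   [e0]. *)
rewrite (eq_big_seq (fun=> mu (d * d) [set v | frames v /\ cone S (e0 *m gs_frame
  v)])) in C2; last first.
  move=> [x y] xy; apply: lebesgue_gs_frame_hit => //.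
  by apply/l2norm_eq1; exact: uG.
have foo := @lebesgue_frames_lty d; have f0 := @lebesgue_frames_gt0 d.
have boo : (mu d (cone (@sphere R d)) < +oo)%E.
  apply: le_lt_trans (lebesgue_rV_sqball_lty d (@ler01 R)).
  apply: le_measure; rewrite ?inE //; first exact: measurable_sqball.
  by rewrite cone_sphereE => x /andP[].
have b0 : (0 < mu d (cone (@sphere R d)))%E.
  (* The punctured closed ball is not open, so positivity comes from its open part, which contains
     [2^-1 *: e0]. *)
  apply: (@lt_le_trans _ _ (mu d ([set x | 0 < sqn x] `&` [set x | sqn x < 1]))).
    apply: lebesgue_rV_open_gt0.
      apply: openI; last exact: open_sqn_lt.
      apply: (@open_comp _ _ (@sqn R d) [set y | 0 < y]); last exact: open_gt.
      by move=> x _; exact: continuous_sqn.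
    by exists (2^-1 *: e0); split; rewrite /= sqnZ e01; lra.
  apply: le_measure; rewrite ?inE //.
    apply: sub_sigma_algebra; apply: openI; last exact: open_sqn_lt.
    apply: (@open_comp _ _ (@sqn R d) [set y | 0 < y]); last exact: open_gt.
    by move=> x _; exact: continuous_sqn.
  by rewrite cone_sphereE => x [/= -> /ltW].
have coo : (mu d (cone S) < +oo)%E.
  apply: le_lt_trans boo; apply: le_measure; rewrite ?inE //.
  by move=> x [t [u Su tx]]; exists t, u => //; exact: sS.
have hoo : (mu (d * d) [set v | frames v /\ cone S (e0 *m gs_frame v)] < +oo)%E.
  apply: le_lt_trans foo; apply: le_measure; rewrite ?inE //.
    exact: (@measurable_frames d).
  by move=> v [].
rewrite /sphere_measure /surface_measure.
apply: (ratio_bound _ _ _ _ _ _ C1 C2) => //; last 2 first.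
- by rewrite b0.
- by rewrite f0.
- by rewrite ge0_fin_numE.
- by rewrite ge0_fin_numE.
Qed.
End averaging.

Theorem proposition1p5 (R : realType) (d : nat) (hd : (0 < d)%N) :
  (tau R d <= Gconst R d)%E.
Proof.
apply: ge_ereal_sup => _ [S [sS bS dS] <-].
apply: le_ereal_inf_tmp => _ [G [uG G0] <-].
exact: sphere_measure_le.
Qed.
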